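(* Let $n=2m$ be a positive even integer. For each $BS$-equivalence class $\mathcal{E}\subseteq NN(n)$ there is a unique $(A;B;C;D)\in\mathcal{E}$ having the canonical form.
   Context: A binary sequence is a finite sequence with terms in $\{+1,-1\}$; we write $+,-$ for $+1,-1$. For a sequence $A=a_1,\ldots,a_k$ put $A(x)=a_1+a_2x+\cdots+a_kx^{k-1}$ and $N(A)=A(x)A(x^{-1})\in\mathbf{Z}[x,x^{-1}]$. Let $-A$ be the termwise negation, $A'=a_k,a_{k-1},\ldots,a_1$ the reversed sequence, and $A^*=a_1,-a_2,a_3,\ldots,(-1)^{k-1}a_k$ the alternated sequence. $BS(n+1,n)$ is the set of quadruples $(A;B;C;D)$ of binary sequences, with $A,B$ of length $n+1$ and $C,D$ of length $n$, such that $N(A)+N(B)+N(C)+N(D)=2(2n+1)$ (such quadruples are called base sequences). For $n$ even, $NN(n)$ (near-normal sequences) is the subset of those $(A;B;C;D)\in BS(n+1,n)$ with $b_i=(-1)^{i-1}a_i$ for $1\le i\le n$ and $b_{n+1}=-a_{n+1}$. Two members of $BS(n+1,n)$ are equivalent if one can be transformed into the other by a finite sequence of elementary transformations: (i) negate one of the four sequences $A;B;C;D$; (ii) reverse one of the sequences $A;B;C;D$; (iii) interchange two of the sequences $A;B;C;D$ of the same length; (iv) alternate all four sequences, i.e. replace $(A;B;C;D)$ by $(A^*;B^*;C^*;D^* )$. Two members of $NN(n)$ are $BS$-equivalent if they are equivalent as members of $BS(n+1,n)$ (intermediate quadruples need not lie in $NN(n)$). The $BS$-equivalence classes are the classes of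 this relation on $NN(n)$. Encoding. Let $n=2m$. The $i$th quad of $(A;B)$ is $\begin{bmatrix} a_i & a_{n+2-i}\\ b_i & b_{n+2-i}\end{bmatrix}$, $1\le i\le m$, with label $p_i$; the $i$th quad of $(C;D)$ is $\begin{bmatrix} c_i & c_{n+1-i}\\ d_i & d_{n+1-i}\end{bmatrix}$, $1\le i\le m$, with label $q_i$. The labels of quads are $0=\begin{bmatrix}+&+\\+&-\end{bmatrix}$, $1=\begin{bmatrix}+&+\\+&+\end{bmatrix}$, $2=\begin{bmatrix}+&+\\-&-\end{bmatrix}$, $3=\begin{bmatrix}-&+\\-&+\end{bmatrix}$, $4=\begin{bmatrix}+&-\\-&+\end{bmatrix}$, $5=\begin{bmatrix}-&+\\+&-\end{bmatrix}$, $6=\begin{bmatrix}+&-\\+&-\end{bmatrix}$, $7=\begin{bmatrix}-&-\\+&+\end{bmatrix}$, $8=\begin{bmatrix}-&-\\-&-\end{bmatrix}$. (It is known that, for $(A;B;C;D)\in BS(n+1,n)$, every quad of $(C;D)$ is one of those labelled $1,\ldots,8$.) Canonical form. $(A;B;C;D)\in NN(n)$ is in the canonical form if: (i) $p_1=0$ and $q_1=1$; (ii) if $q_j=2$ for some $j$, then $q_i=7$ for some index $i$ with $1<i<j$; (iii) if $q_j\in\{3,4,5\}$ for some $j$, then $q_i=6$ for some index $i$ with $1<i<j$; (iv) if $q_k\ne 7$ for all $k$ and $q_j=4$ for some $j$, then $q_i=5$ for some index $i$ with $1<i<j$. *)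

(* Defs.v *)
From Stdlib Require Import Relation_Operators.
From mathcomp Require Import all_boot all_order all_algebra.

Set Implicit Arguments.
Unset Strict Implicit.
Unset Printing Implicit Defensive.

Import GRing.Theory.
Local Open Scope ring_scope.

Definition binary (s : seq int) : bool := all (fun x => (x == 1) || (x == -1)) s.

(* [term s i] is the i-th term in the 1-based indexing s = s_1, ..., s_k. *)
Definition term (s : seq int) (i : nat) : int := s`_i.-1.

(* The Laurent polynomial ring Z[x, x^-1] is viewed inside its field of
   fractions Z(x). *)
Notation Zx := {fraction {poly int}}.

Definition genfun (s : seq int) (t : Zx) : Zx :=
  (map_poly (intr : int -> Zx) (Poly s)).[t].

Definition normseq (s : seq int) : Zx :=
  let x : Zx := tofrac 'X in genfun s x * genfun s x^-1.

Definition negate (s : seq int) : seq int := map -%R s.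

Definition alternate (s : seq int) : seq int :=
  mkseq (fun i => (-1) ^+ i * s`_i) (size s).

Record quadruple := Quadruple {
  seqA : seq int; seqB : seq int; seqC : seq int; seqD : seq int }.

(* [BS n] is the set written BS(n+1,n). *)
Definition BS (n : nat) (X : quadruple) : Prop :=
  let: Quadruple A B C D := X in
  [/\ [&& binary A, binary B, binary C & binary D],
      [/\ size A = n.+1, size B = n.+1, size C = n & size D = n]
    & normseq A + normseq B + normseq C + normseq D = (2 * (2 * n + 1))%N%:R].

Definition NN (n : nat) (X : quadruple) : Prop :=
  [/\ BS n X,
      forall i, (1 <= i <= n)%N ->
        term (seqB X) i = (-1) ^+ i.-1 * term (seqA X) i
    & term (seqB X) n.+1 = - term (seqA X) n.+1].

(* In BS(n+1,n) the pairs of sequences of the same length are A, B and C, D. *)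
Inductive elementary : quadruple -> quadruple -> Prop :=
| NegA A B C D : elementary (Quadruple A B C D) (Quadruple (negate A) B C D)
| NegB A B C D : elementary (Quadruple A B C D) (Quadruple A (negate B) C D)
| NegC A B C D : elementary (Quadruple A B C D) (Quadruple A B (negate C) D)
| NegD A B C D : elementary (Quadruple A B C D) (Quadruple A B C (negate D))
| RevA A B C D : elementary (Quadruple A B C D) (Quadruple (rev A) B C D)
| RevB A B C D : elementary (Quadruple A B C D) (Quadruple A (rev B) C D)
| RevC A B C D : elementary (Quadruple A B C D) (Quadruple A B (rev C) D)
| RevD A B C D : elementary (Quadruple A B C D) (Quadruple A B C (rev D))
| SwapAB A B C D : elementary (Quadruple A B C D) (Quadruple B A C D)
| SwapCD A B C D : elementary (Quadruple A B C D) (Quadruple A B D C)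
| AltAll A B C D : elementary (Quadruple A B C D)
    (Quadruple (alternate A) (alternate B) (alternate C) (alternate D)).

(* Each elementary transformation maps BS(n+1,n) to itself, so intermediate
   quadruples need not be constrained. *)
Definition BS_equiv : quadruple -> quadruple -> Prop :=
  clos_refl_trans quadruple elementary.

Definition BS_class (n : nat) (E : quadruple -> Prop) : Prop :=
  exists2 X, NN n X & forall Y, E Y <-> NN n Y /\ BS_equiv X Y.

(* [((a, a'), (b, b'))] is the quad with rows a, a' and b, b'. *)
Notation quad := ((int * int) * (int * int))%type.

(* The quad at position k is the one labelled k. *)
Definition quads : seq quad :=
  [:: (( 1,  1), ( 1, -1));
      (( 1,  1), ( 1,  1));
      (( 1,  1), (-1, -1));
      ((-1,  1), (-1,  1));
      (( 1, -1), (-1,  1));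
      ((-1,  1), ( 1, -1));
      (( 1, -1), ( 1, -1));
      ((-1, -1), ( 1,  1));
      ((-1, -1), (-1, -1)) ].

(* Quads without a label get the junk value 9. *)
Definition label (Q : quad) : nat := index Q quads.

Definition labelp (m : nat) (X : quadruple) (i : nat) : nat :=
  let n := (2 * m)%N in
  label ((term (seqA X) i, term (seqA X) (n + 2 - i)),
         (term (seqB X) i, term (seqB X) (n + 2 - i))).

Definition labelq (m : nat) (X : quadruple) (i : nat) : nat :=
  let n := (2 * m)%N in
  label ((term (seqC X) i, term (seqC X) (n + 1 - i)),
         (term (seqD X) i, term (seqD X) (n + 1 - i))).

Definition canonical_form (m : nat) (X : quadruple) : Prop :=
  let p := labelp m X in
  let q := labelq m X in
  [/\ p 1%N = 0%N /\ q 1%N = 1%N,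
      forall j, (1 <= j <= m)%N -> q j = 2%N ->
        exists2 i, (1 < i < j)%N & q i = 7%N,
      forall j, (1 <= j <= m)%N -> q j \in [:: 3%N; 4%N; 5%N] ->
        exists2 i, (1 < i < j)%N & q i = 6%N
    & (forall k, (1 <= k <= m)%N -> q k <> 7%N) ->
      forall j, (1 <= j <= m)%N -> q j = 4%N ->
        exists2 i, (1 < i < j)%N & q i = 5%N].

(* Main.v *)
Require Import Defs.
From mathcomp Require Import all_boot all_order all_algebra.
From mathcomp Require Import zify ring.
From Stdlib Require Import Relation_Operators Operators_Properties.

Set Implicit Arguments.
Unset Strict Implicit.
Unset Printing Implicit Defensive.

Import GRing.Theory.
Local Open Scope ring_scope.

(**
  Both halves rest on one arithmetic fact.  For 0 <= k < n the coefficient of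
  x^(k-n) in N(A) + N(B) + N(C) + N(D) is a vanishing sum of 4k + 2 signs, so
  it has 2k + 1 negative terms and the product of its terms is -1
  ([prod_mirror]).  The terms multiply up to mirror pairs, that is products
  of two entries at equal distance from the two ends of one of the sequences.
  For near-normal sequences with n even, the alternation rule makes every
  interior mirror pair of A cancel that of B, and comparing consecutive
  coefficients shows that in every quad of (C;D) the two rows have the same
  product ([NN_mirrorCD]): either both rows are constant
  (labels 1, 2, 7, 8) or both are skew (labels 3, 4, 5, 6).  On those eight
  labels, reversing C, reversing D and interchanging C with D act by fixed
  permutations.

  Existence ([canonical_exists]).  Exactly one of A, B has equal end terms;
  moving it to the first place and negating both if needed gives p_1 = 0.
  As n is even, alternation changes the sign of the product of the end terms
  of C and of D, so it can make these products 1; negations then give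
  q_1 = 1.  Reversals of C and D act simply transitively on the skew labels,
  hence can turn the first skew label into 6.  The interchange of C and D
  fixes 6 and exchanges 2 with 7 and 4 with 5, so it can make the first label
  in {2, 7}, or in {4, 5} if there is none, the required one.  All these moves
  preserve near-normality.

  Uniqueness ([canonical_unique]).  An equivalence sends (A, B), alternated
  or not, to sequences that agree with them up to order, sign and reversal,
  and likewise for (C, D) ([BS_equiv_akin]).  The product of the end terms is
  unchanged by negation and reversal but changes sign in C and D under
  alternation, so q_1 = 1 on both sides rules out alternation.  It also
  separates A from B, and then A and B are fixed ([unique_AB]).  For (C;D) no
  sign change is possible; a reversal would move the first skew label away
  from 6 unless there is no skew quad, in which case reversals act trivially
  ([unique_revert]); and an interchange would destroy the condition on {2, 7}
  or on {4, 5} unless neither set of labels occurs, in which case C = D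
  ([unique_CD]).
*)

(** * Operations on sequences *)

Lemma size_negate s : size (negate s) = size s.
Proof. exact: size_map. Qed.

Lemma size_alternate s : size (alternate s) = size s.
Proof. exact: size_mkseq. Qed.

Lemma nth_negate s i : (negate s)`_i = - s`_i.
Proof.
have [lt_is | le_si] := ltnP i (size s); first exact: nth_map.
by rewrite !nth_default ?size_negate ?oppr0.
Qed.

Lemma nth_alternate s i : (alternate s)`_i = (-1) ^+ i * s`_i.
Proof.
have [lt_is | le_si] := ltnP i (size s); first exact: nth_mkseq.
by rewrite !nth_default ?size_alternate ?mulr0.
Qed.

Lemma eq_from_coef (s t : seq int) :
  size s = size t -> (forall i, (i < size s)%N -> s`_i = t`_i) -> s = t.
Proof. exact: eq_from_nth. Qed.

Lemma negateK : involutive negate.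
Proof. exact: (mapK (@opprK _)). Qed.

Lemma rev_negate s : rev (negate s) = negate (rev s).
Proof. by rewrite /negate map_rev. Qed.

Lemma alternate_negate s : alternate (negate s) = negate (alternate s).
Proof.
apply: eq_from_coef => [|i _]; first by rewrite !(size_negate, size_alternate).
by rewrite !(nth_alternate, nth_negate) mulrN.
Qed.

Lemma alternateK : involutive alternate.
Proof.
move=> s; apply: eq_from_coef => [|i _]; first by rewrite !size_alternate.
by rewrite !nth_alternate mulrA -expr2 sqrr_sign mul1r.
Qed.

(** Term i of the reversal is term k-1-i, with sign (-1)^(k-1-i), where k is the
    length: the two alternations differ by the constant sign (-1)^(k-1). *)
Lemma nth_rev_alternate s i : (i < size s)%N ->
  (rev (alternate s))`_i = (-1) ^+ (size s).-1 * (alternate (rev s))`_i.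
Proof.
move=> lt_is; rewrite nth_rev ?size_alternate // !nth_alternate nth_rev // mulrA.
suff ->: (-1) ^+ (size s).-1 * (-1) ^+ i = (-1) ^+ (size s - i.+1) :> int by [].
have ->: ((size s).-1 = size s - i.+1 + i)%N by lia.
by rewrite exprD -mulrA -expr2 sqrr_sign mulr1.
Qed.

Lemma rev_alternate s :
  rev (alternate s) = alternate (rev s) \/
  rev (alternate s) = negate (alternate (rev s)).
Proof.
case odd_s: (odd (size s).-1); [right | left]; apply: eq_from_coef => [|i];
  rewrite !(size_negate, size_rev, size_alternate) // => lt_is;
  rewrite nth_rev_alternate // ?nth_negate -signr_odd odd_s ?mulN1r ?mul1r //.
Qed.

Lemma binary_nth s i :
  binary s -> (i < size s)%N -> s`_i = 1 \/ s`_i = -1.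
Proof.
move=> /allP bin_s lt_is.
by have /orP[/eqP | /eqP] := bin_s _ (mem_nth 0 lt_is); [left | right].
Qed.

Lemma binary_rev s : binary (rev s) = binary s.
Proof. exact: all_rev. Qed.

Lemma binary_negate s : binary (negate s) = binary s.
Proof.
by rewrite /binary all_map; apply: eq_all => x /=; rewrite !eqr_oppLR opprK orbC.
Qed.

Lemma binary_alternate s : binary s -> binary (alternate s).
Proof.
move=> bin_s; apply/(all_nthP 0) => i; rewrite size_alternate => lt_is.
rewrite nth_alternate -signr_odd.
by case: (odd i); case: (binary_nth bin_s lt_is) => ->.
Qed.

(** * Norms as polynomial autocorrelations *)

(** Equal to x^(k-1) N(s) for s of length k: a polynomial whose coefficients are
    the autocorrelations of s. *)
Definition corr (s : seq int) : {poly int} := Poly s * Poly (rev s).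

Lemma corr_rev s : corr (rev s) = corr s.
Proof. by rewrite /corr revK mulrC. Qed.

Lemma Poly_negate s : Poly (negate s) = - Poly s.
Proof. by apply/polyP => i; rewrite coefN !coef_Poly nth_negate. Qed.

Lemma corr_negate s : corr (negate s) = corr s.
Proof. by rewrite /corr rev_negate !Poly_negate mulrNN. Qed.

Lemma Poly_alternate s : Poly (alternate s) = Poly s \Po (- 'X).
Proof.
elim: s => [|a s IHs]; first by rewrite comp_poly0.
have ->: alternate (a :: s) = a :: negate (alternate s).
  apply: eq_from_coef => [|i]; first by rewrite size_alternate /= size_negate size_alternate.
  rewrite nth_alternate; case: i => [|i] _ /=; first by rewrite mul1r.
  by rewrite nth_negate nth_alternate exprS !mulN1r mulNr.
rewrite /= !cons_poly_def Poly_negate IHs.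
by rewrite comp_polyD comp_polyM comp_polyX comp_polyC mulNr mulrN.
Qed.

Lemma corr_alternate s :
  corr (alternate s) = (-1) ^+ (size s).-1 * (corr s \Po (- 'X)).
Proof.
have rev_alt: Poly (rev (alternate s))
    = (-1) ^+ (size s).-1 * Poly (alternate (rev s)).
  have ->: (-1) ^+ (size s).-1 = ((-1) ^+ (size s).-1)%:P :> {poly int}.
    by rewrite rmorphXn rmorphN.
  apply/polyP => i; rewrite coefCM !coef_Poly.
  have [lt_is | le_si] := ltnP i (size s); first exact: nth_rev_alternate.
  by rewrite !nth_default ?mulr0 ?(size_rev, size_alternate).
by rewrite /corr rev_alt !Poly_alternate mulrCA comp_polyM.
Qed.

Local Notation x := (tofrac 'X : Zx).

Lemma x_neq0 : x != 0.
Proof. by rewrite tofrac_eq0 polyX_eq0. Qed.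

Lemma tofrac_int (a : int) : tofrac a%:P = a%:~R :> Zx.
Proof. by rewrite -[a in LHS]intz !rmorph_int. Qed.

Lemma genfun_cons a s t : genfun (a :: s) t = genfun s t * t + a%:~R.
Proof.
by rewrite /genfun /= cons_poly_def rmorphD rmorphM /= map_polyX map_polyC !hornerE.
Qed.

Lemma genfun_nil t : genfun [::] t = 0.
Proof. by rewrite /genfun /= rmorph0 horner0. Qed.

Lemma genfun_x s : genfun s x = tofrac (Poly s).
Proof.
elim: s => [|a s IHs]; first by rewrite genfun_nil /= rmorph0.
by rewrite genfun_cons IHs /= cons_poly_def rmorphD rmorphM /= tofrac_int.
Qed.

Lemma Poly_rcons (s : seq int) a : Poly (rcons s a) = Poly s + a%:P * 'X^(size s).
Proof.
elim: s => [|b s IHs] /=; rewrite !cons_poly_def ?mul0r ?add0r ?expr0 ?mulr1 //.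
by rewrite IHs exprSr; ring.
Qed.

(** The factor x on the right makes the formula hold also for the empty sequence. *)
Lemma genfun_xV s : genfun s x^-1 * x ^+ size s = tofrac (Poly (rev s)) * x.
Proof.
elim: s => [|a s IHs]; first by rewrite genfun_nil /= rmorph0 !mul0r.
rewrite genfun_cons rev_cons Poly_rcons size_rev rmorphD rmorphM /= rmorphXn /=.
rewrite tofrac_int !mulrDl -IHs; congr (_ + _); last by rewrite exprSr mulrA.
by rewrite exprS mulrA mulfVK ?x_neq0.
Qed.

Lemma normseq_corr s : normseq s * x ^+ size s = tofrac (corr s) * x.
Proof. by rewrite /normseq genfun_x -mulrA genfun_xV mulrA -rmorphM. Qed.

(** The condition defining base sequences, multiplied by x^n; it replaces
    computations in the field of fractions by computations with polynomials. *)
Lemma base_eqP n A B C D :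
    size A = n.+1 -> size B = n.+1 -> size C = n -> size D = n ->
  normseq A + normseq B + normseq C + normseq D = (2 * (2 * n + 1))%N%:R
  <-> corr A + corr B + (corr C + corr D) * 'X = (2 * (2 * n + 1))%N%:R * 'X^n.
Proof.
move=> sA sB sC sD.
set c := (2 * _)%N.
have eqL: (normseq A + normseq B + normseq C + normseq D) * x ^+ n.+1
    = tofrac (corr A + corr B + (corr C + corr D) * 'X) * x.
  rewrite mulrDl (mulrDl _ (normseq C)) (mulrDl (normseq A)).
  rewrite -{1}sA -sB !normseq_corr sB exprSr !mulrA.
  by rewrite -{1}sC -sD !normseq_corr !(rmorphD, rmorphM) /=; ring.
have eqR: c%:R * x ^+ n.+1 = tofrac (c%:R * 'X^n) * x.
  by rewrite rmorphM /= rmorph_nat rmorphXn /= exprSr mulrA.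
split=> [eqN | eqP].
  have := eqL; rewrite eqN eqR => /(mulIf x_neq0)/eqP.
  by rewrite tofrac_eq => /eqP.
apply: (mulIf (expf_neq0 n.+1 x_neq0)).
by rewrite eqL eqR eqP.
Qed.

Lemma normseq_rev s : normseq (rev s) = normseq s.
Proof.
apply: (mulIf (expf_neq0 (size s) x_neq0)).
by rewrite -{1}size_rev !normseq_corr corr_rev.
Qed.

Lemma normseq_negate s : normseq (negate s) = normseq s.
Proof.
apply: (mulIf (expf_neq0 (size s) x_neq0)).
by rewrite -{1}size_negate !normseq_corr corr_negate.
Qed.

(** Alternation substitutes -x for x. For n even the signs (-1)^(k-1) of
    [corr_alternate] are 1 for A, B and -1 for C, D, and the latter is absorbed
    by the factor x in front of the terms of C and D. *)
Lemma base_alternate n A B C D : ~~ odd n ->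
    size A = n.+1 -> size B = n.+1 -> size C = n -> size D = n ->
  normseq A + normseq B + normseq C + normseq D = (2 * (2 * n + 1))%N%:R ->
  normseq (alternate A) + normseq (alternate B) + normseq (alternate C)
    + normseq (alternate D) = (2 * (2 * n + 1))%N%:R.
Proof.
move=> even_n sA sB sC sD; rewrite !(@base_eqP n) ?size_alternate //.
set c := (2 * _)%N => /(congr1 (fun p => p \Po (- 'X))) eqP.
have sgn1: (-1) ^+ n = 1 :> {poly int} by rewrite -signr_odd (negbTE even_n).
move: eqP; rewrite comp_polyD comp_polyD !corr_alternate sA sB sC sD /= !sgn1.
rewrite (comp_polyM (_ + _) 'X) (comp_polyM c%:R) comp_polyD comp_polyX.
rewrite -[c%:R in X in X -> _]polyC_natr comp_polyC polyC_natr.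
rewrite comp_Xn_poly (exprNn 'X) sgn1 !mul1r => <-.
have [n0 | n_gt0] := posnP n.
  have [C0 D0] : C = [::] /\ D = [::] by split; apply: size0nil; rewrite ?sC ?sD.
  by rewrite C0 D0 /corr /= !mul0r !comp_poly0 !(addr0, mulr0, mul0r).
have ->: (-1) ^+ n.-1 = -1 :> {poly int}.
  move: sgn1; rewrite -{1}(prednK n_gt0) exprS mulN1r => /eqP.
  by rewrite eqr_oppLR => /eqP.
by rewrite -mulrDr mulN1r mulNr mulrN.
Qed.

(** * Products of mirror pairs *)

Definition mirror (s : seq int) (i : nat) : int := s`_i * s`_(size s - i.+1).

(** The terms of the autocorrelation of s at the shift size s - k. *)
Definition overlap (s : seq int) (k : nat) : seq int :=
  mkseq (fun i => s`_i * s`_(size s - (k - i))) k.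

Lemma size_overlap s k : size (overlap s k) = k.
Proof. exact: size_mkseq. Qed.

Lemma binary_overlap s k :
  binary s -> (k <= size s)%N -> binary (overlap s k).
Proof.
move=> bin_s le_ks; apply/(all_nthP 0) => i; rewrite size_overlap => lt_ik.
rewrite nth_mkseq //.
have lt1: (i < size s)%N by lia.
have lt2: (size s - (k - i) < size s)%N by lia.
by case: (binary_nth bin_s lt1) => ->; case: (binary_nth bin_s lt2) => ->.
Qed.

Lemma sum_overlap s k : (k <= size s)%N ->
  \sum_(y <- overlap s k) y = (corr s * 'X)`_k.
Proof.
rewrite coefMX /overlap /mkseq big_map.
rewrite -[X in iota 0 X]subn0 -/(index_iota 0 k) big_mkord.
case: k => [|j] lt_js /=; first by rewrite big_ord0.
rewrite coefM; apply: eq_bigr => i _; rewrite !coef_Poly nth_rev; last first.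
  exact: leq_ltn_trans (leq_subr _ _) lt_js.
by rewrite subSn // -ltnS.
Qed.

(** The factors are the first k terms and the last k terms of s; pairing them
    from the outside inwards gives mirror pairs. *)
Lemma prod_overlap s k : (k <= size s)%N ->
  \prod_(y <- overlap s k) y = \prod_(i < k) mirror s i.
Proof.
move=> le_ks; rewrite /overlap /mkseq big_map.
rewrite -[X in iota 0 X]subn0 -/(index_iota 0 k) big_mkord !big_split /=.
congr (_ * _); rewrite (reindex_inj rev_ord_inj) /=.
apply: eq_bigr => i _; congr (s`_(_ - _)).
by have := ltn_ord i; lia.
Qed.

Lemma sum_prod_signs (r : seq int) : binary r ->
  exists k : nat, \sum_(y <- r) y = (size r)%:Z - (2 * k)%N%:Z
    /\ \prod_(y <- r) y = (-1) ^+ k.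
Proof.
elim: r => [_ | y r IHr /= /andP[y_sgn /IHr[k [sum_r prod_r]]]].
  by exists 0%N; rewrite !big_nil.
rewrite !big_cons sum_r prod_r.
case/orP: y_sgn => /eqP ->; [exists k | exists k.+1].
  by rewrite mul1r; split=> //; lia.
by rewrite exprS; split=> //; lia.
Qed.

Lemma binary_cat s t : binary (s ++ t) = binary s && binary t.
Proof. exact: all_cat. Qed.

(** A vanishing sum of 4j + 2 signs has 2j + 1 negative terms. *)
Lemma prod_balanced_signs (r : seq int) (j : nat) :
    binary r -> size r = (4 * j + 2)%N -> \sum_(y <- r) y = 0 ->
  \prod_(y <- r) y = -1.
Proof.
move=> /sum_prod_signs[k [-> ->]] -> sum0.
have ->: k = (2 * j).+1 by lia.
by rewrite exprS exprM sqrrN !expr1n mulr1.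
Qed.

(** The coefficient of x^k of the polynomial identity consists of k + 1 terms
    for each of A, B and k terms for each of C, D. *)
Lemma prod_mirror n A B C D k : BS n (Quadruple A B C D) -> (k < n)%N ->
  (\prod_(i < k.+1) (mirror A i * mirror B i))
    * (\prod_(i < k) (mirror C i * mirror D i)) = -1.
Proof.
case=> /and4P[bA bB bC bD] [sA sB sC sD].
(* The additional factor 'X puts the terms of A and B in the form of [sum_overlap]. *)
rewrite (@base_eqP n) // => /(congr1 (fun p : {poly int} => (p * 'X)`_k.+1)) eqk lt_kn.
pose r := overlap A k.+1 ++ overlap B k.+1 ++ overlap C k ++ overlap D k.
rewrite -(@prod_balanced_signs r k).
- rewrite !big_cat /= !prod_overlap ?sA ?sB ?sC ?sD ?big_split /= ?mulrA //; lia.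
- by rewrite !binary_cat !binary_overlap ?sA ?sB ?sC ?sD ?(ltnW lt_kn) // ltnW.
- by rewrite !size_cat !size_overlap; lia.
rewrite !big_cat /= !sum_overlap ?sA ?sB ?sC ?sD; try lia.
move: eqk; rewrite !mulrDl !coefD !(coefMX (_ * 'X)) /= => eqk.
rewrite addrA addrA -addrA eqk -polyC_natr -mulrA -exprSr coefCM coefXn.
by rewrite eqSS ltn_eqF ?mulr0.
Qed.

Lemma NN_size n X : NN n X ->
  [/\ size (seqA X) = n.+1, size (seqB X) = n.+1,
      size (seqC X) = n & size (seqD X) = n].
Proof. by case: X => A B C D [[]]. Qed.

Lemma NN_binary n X : NN n X ->
  [/\ binary (seqA X), binary (seqB X), binary (seqC X) & binary (seqD X)].
Proof. by case: X => A B C D [[/and4P]]. Qed.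

Lemma NN_nthB n X i : NN n X -> (i < n)%N ->
  (seqB X)`_i = (-1) ^+ i * (seqA X)`_i.
Proof. by case=> _ defB _ lt_in; apply: (defB i.+1). Qed.

Lemma NN_lastB n X : NN n X -> (seqB X)`_n = - (seqA X)`_n.
Proof. by case. Qed.

(** Both signs (-1)^i and (-1)^(n-i) relating B to A occur, and their product is
    (-1)^n. *)
Lemma NN_mirrorAB n X i : NN n X -> ~~ odd n -> (0 < i < n)%N ->
  mirror (seqA X) i * mirror (seqB X) i = 1.
Proof.
move=> nnX even_n /andP[i_gt0 lt_in].
have [sA sB _ _] := NN_size nnX; have [bA _ _ _] := NN_binary nnX.
rewrite /mirror sA sB !subSS !(NN_nthB nnX) //; last by lia.
have sqr1 j : (j < n.+1)%N -> (seqA X)`_j * (seqA X)`_j = 1.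
  by rewrite -sA => lt_j; case: (binary_nth bA lt_j) => ->.
rewrite [LHS](_ : _ = (-1) ^+ i * (-1) ^+ (n - i)
  * ((seqA X)`_i * (seqA X)`_i) * ((seqA X)`_(n - i) * (seqA X)`_(n - i))); last by ring.
rewrite !sqr1 ?mulr1 -?exprD; try lia.
by rewrite subnKC 1?ltnW // -signr_odd (negbTE even_n).
Qed.

(** By induction all factors of [prod_mirror] but the outermost pair of (A;B)
    and the pair i of (C;D) are 1; the case k = 0 says that the former is -1. *)
Lemma NN_mirrorCD n X i : NN n X -> ~~ odd n -> (i.+1 < n)%N ->
  mirror (seqC X) i * mirror (seqD X) i = 1.
Proof.
move=> nnX even_n; elim/ltn_ind: i => i IHi lt_in.
have [bsX _ _] := nnX; case: X bsX nnX IHi => A B C D bsX nnX /= IHi.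
have := prod_mirror bsX lt_in; rewrite big_ord_recl big1 => [|j _]; last first.
  by apply: (NN_mirrorAB nnX) => //=; rewrite /bump; have := ltn_ord j; lia.
rewrite big_ord_recr big1 /= => [|j _]; last by apply: IHi; have := ltn_ord j; lia.
have := prod_mirror bsX (leq_ltn_trans (leq0n _) lt_in).
by rewrite big_ord_recr !big_ord0 /= !mul1r !mulr1 => ->; rewrite mulN1r => /oppr_inj.
Qed.

(** * Moves within near-normal sequences *)

(** Near-normality constrains C and D only through the sum of their norms. *)
Lemma NN_change_CD n A B C D C' D' :
    binary C' -> binary D' -> size C' = n -> size D' = n ->
    normseq C' + normseq D' = normseq C + normseq D ->
  NN n (Quadruple A B C D) -> NN n (Quadruple A B C' D').
Proof.
move=> bC' bD' sC' sD' eqN [[/and4P[bA bB _ _] [sA sB _ _] normX] defB lastB].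
split=> //; split=> //; first exact/and4P.
by rewrite -addrA eqN addrA.
Qed.

Definition nn_equiv n X Y := NN n Y /\ BS_equiv X Y.

Lemma nn_equiv_trans n X Y Z : nn_equiv n X Y -> nn_equiv n Y Z -> nn_equiv n X Z.
Proof. by move=> [_ eXY] [nnZ eYZ]; split=> //; apply: rt_trans eXY eYZ. Qed.

Lemma nn_equiv_refl n X : NN n X -> nn_equiv n X X.
Proof. by move=> nnX; split=> //; apply: rt_refl. Qed.

Section Moves.

Variables (n : nat) (A B C D : seq int).
Hypothesis nnX : NN n (Quadruple A B C D).

Lemma nn_negC : nn_equiv n (Quadruple A B C D) (Quadruple A B (negate C) D).
Proof.
have [/= _ _ sC sD] := NN_size nnX; have [/= _ _ bC bD] := NN_binary nnX.
split; last by apply/rt_step/NegC.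
by apply: NN_change_CD nnX; rewrite ?size_negate ?binary_negate ?normseq_negate.
Qed.

Lemma nn_negD : nn_equiv n (Quadruple A B C D) (Quadruple A B C (negate D)).
Proof.
have [/= _ _ sC sD] := NN_size nnX; have [/= _ _ bC bD] := NN_binary nnX.
split; last by apply/rt_step/NegD.
by apply: NN_change_CD nnX; rewrite ?size_negate ?binary_negate ?normseq_negate.
Qed.

Lemma nn_revC : nn_equiv n (Quadruple A B C D) (Quadruple A B (rev C) D).
Proof.
have [/= _ _ sC sD] := NN_size nnX; have [/= _ _ bC bD] := NN_binary nnX.
split; last by apply/rt_step/RevC.
by apply: NN_change_CD nnX; rewrite ?size_rev ?binary_rev ?normseq_rev.
Qed.

Lemma nn_revD : nn_equiv n (Quadruple A B C D) (Quadruple A B C (rev D)).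
Proof.
have [/= _ _ sC sD] := NN_size nnX; have [/= _ _ bC bD] := NN_binary nnX.
split; last by apply/rt_step/RevD.
by apply: NN_change_CD nnX; rewrite ?size_rev ?binary_rev ?normseq_rev.
Qed.

Lemma nn_swapCD : nn_equiv n (Quadruple A B C D) (Quadruple A B D C).
Proof.
have [/= _ _ sC sD] := NN_size nnX; have [/= _ _ bC bD] := NN_binary nnX.
split; last by apply/rt_step/SwapCD.
by apply: NN_change_CD nnX => //; rewrite addrC.
Qed.

(** The relation between A and B is symmetric: alternating the first n terms is an
    involution, and so is the negation of the last one. *)
Lemma nn_swapAB : nn_equiv n (Quadruple A B C D) (Quadruple B A C D).
Proof.
split; last by apply/rt_step/SwapAB.
case: nnX => [[/and4P[bA bB bC bD] [sA sB sC sD] normX] defB lastB].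
split; first by split=> //; [apply/and4P | rewrite [normseq B + _]addrC].
  by move=> i /defB /= ->; rewrite mulrA -expr2 sqrr_sign mul1r.
by move: lastB => /= ->; rewrite opprK.
Qed.

Lemma nn_negAB :
  nn_equiv n (Quadruple A B C D) (Quadruple (negate A) (negate B) C D).
Proof.
split; last by apply: rt_trans (rt_step _ _ _ _ (NegB _ _ _ _)); apply/rt_step/NegA.
case: nnX => [[/and4P[bA bB bC bD] [sA sB sC sD] normX] defB lastB].
split; first split; rewrite ?size_negate ?binary_negate ?normseq_negate //.
- exact/and4P.
- by move=> i /defB /=; rewrite /term !nth_negate => ->; rewrite mulrN.
by move: lastB; rewrite /= /term !nth_negate => ->.
Qed.

(** Alternating both A and B multiplies b_i and a_i by the same sign. *)
Lemma nn_alternate : ~~ odd n -> nn_equiv n (Quadruple A B C D)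
  (Quadruple (alternate A) (alternate B) (alternate C) (alternate D)).
Proof.
move=> even_n; split; last by apply/rt_step/AltAll.
case: nnX => [[/and4P[bA bB bC bD] [sA sB sC sD] normX] defB lastB].
split; first split; rewrite ?size_alternate //.
- by apply/and4P; split; apply: binary_alternate.
- exact: base_alternate normX.
- by move=> i /defB /=; rewrite /term !nth_alternate => ->.
by move: lastB; rewrite /= /term !nth_alternate /= => ->; rewrite mulrN.
Qed.

End Moves.

(** * Invariants of equivalence *)

(** The orbit of s under negation and reversal: these commute and are
    involutions, hence four elements. *)
Definition akin (s t : seq int) : Prop :=
  [\/ t = s, t = negate s, t = rev s | t = negate (rev s)].

Lemma akin_negate s t : akin s t -> akin s (negate t).
Proof.
by case=> ->; rewrite ?negateK;
  [constructor 2 | constructor 1 | constructor 4 | constructor 3].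
Qed.

Lemma akin_rev s t : akin s t -> akin s (rev t).
Proof.
by case=> ->; rewrite ?rev_negate ?revK;
  [constructor 3 | constructor 4 | constructor 1 | constructor 2].
Qed.

Lemma akin_alternate s t : akin s t -> akin (alternate s) (alternate t).
Proof.
have akin_alt_rev: akin (alternate s) (alternate (rev s)).
  case: (rev_alternate s) => eq_rev; first by constructor 3.
  by constructor 4; rewrite eq_rev negateK.
case=> ->; rewrite ?alternate_negate //; first by constructor 1.
  by constructor 2.
exact: akin_negate.
Qed.

Definition akin_pair (s t s' t' : seq int) : Prop :=
  (akin s s' /\ akin t t') \/ (akin t s' /\ akin s t').

Definition alternate_if (e : bool) s := if e then alternate s else s.

Lemma akin_alternate_if e s t :
  akin (alternate_if e s) t -> akin (alternate_if (~~ e) s) (alternate t).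
Proof.
by move/akin_alternate; case: e; rewrite /alternate_if //= alternateK.
Qed.

(** Alternation commutes with the other transformations up to a negation, so only
    the parity e of the number of alternations matters. *)
Lemma BS_equiv_akin X Y : BS_equiv X Y ->
  exists e, let alt := alternate_if e in
    akin_pair (alt (seqA X)) (alt (seqB X)) (seqA Y) (seqB Y) /\
    akin_pair (alt (seqC X)) (alt (seqD X)) (seqC Y) (seqD Y).
Proof.
move/clos_rt_rtn1_iff; elim=> [|Y' Z stepYZ _ [e [pAB pCD]]].
  by exists false; split; left; split; constructor 1.
case: stepYZ pAB pCD => A B C D /= pAB pCD.
11: exists (~~ e); split; [case: pAB | case: pCD] => -[h1 h2]; [left | right | left | right];
  by split; apply: akin_alternate_if.
all: exists e; split=> //; (case: pAB pCD => -[a1 a2] [] [c1 c2]);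
  first [by left; split; auto using akin_negate, akin_rev
        |by right; split; auto using akin_negate, akin_rev].
Qed.

Lemma mirror_negate s i : mirror (negate s) i = mirror s i.
Proof. by rewrite /mirror size_negate !nth_negate mulrNN. Qed.

Lemma mirror_rev s i : (i < size s)%N -> mirror (rev s) i = mirror s i.
Proof.
move=> lt_is; rewrite /mirror size_rev !nth_rev //; last by rewrite ltn_subrL; lia.
by rewrite mulrC; congr (s`__ * _); rewrite subnSK // subKn // ltnW.
Qed.

Lemma mirror_alternate s i : (i < size s)%N ->
  mirror (alternate s) i = (-1) ^+ (size s).-1 * mirror s i.
Proof.
move=> lt_is; rewrite /mirror size_alternate !nth_alternate mulrACA -exprD.
by congr ((-1) ^+ _ * _); lia.
Qed.

Lemma akin_mirror s t i : (i < size s)%N -> akin s t -> mirror t i = mirror s i.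
Proof. by move=> lt_is [] ->; rewrite ?mirror_negate ?mirror_rev. Qed.

(** * Quads and their labels *)

(** The row of the i-th quad that comes from s, with i counted from 1: the second
    entry is the term n+2-i for s of length n+1, and n+1-i for length n. *)
Definition row (s : seq int) (i : nat) : int * int := (s`_i.-1, s`_(size s - i)).

Lemma row_rev s i : (1 <= i <= size s)%N ->
  row (rev s) i = ((row s i).2, (row s i).1).
Proof.
case: i => // i /andP[_ lt_is]; rewrite /row size_rev !nth_rev //=; last first.
  by rewrite ltn_subrL; lia.
by rewrite subnSK // subKn // ltnW.
Qed.

Lemma labelqE m X i : NN (2 * m)%N X ->
  labelq m X i = label (row (seqC X) i, row (seqD X) i).
Proof.
move/NN_size=> [_ _ sC sD]; rewrite /labelq /row /term sC sD.
by have ->: (2 * m + 1 - i).-1 = (2 * m - i)%N by lia.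
Qed.

Lemma labelpE m X i : NN (2 * m)%N X ->
  labelp m X i = label (row (seqA X) i, row (seqB X) i).
Proof.
move/NN_size=> [sA sB _ _]; rewrite /labelp /row /term sA sB.
by have ->: (2 * m + 2 - i).-1 = ((2 * m).+1 - i)%N by lia.
Qed.

Definition is_sign (a : int) := a = 1 \/ a = -1.

Definition sign_row (r : int * int) := is_sign r.1 /\ is_sign r.2.

Definition balanced (r t : int * int) :=
  [/\ sign_row r, sign_row t & r.1 * r.2 = t.1 * t.2].

Lemma row_sign s i : binary s -> (1 <= i <= size s)%N -> sign_row (row s i).
Proof.
move=> bs /andP[i_gt0 le_is].
by split; apply: binary_nth => //=; [rewrite prednK | rewrite ltn_subrL i_gt0 (leq_trans i_gt0)].
Qed.

Lemma mirrorE s i : (0 < i)%N -> mirror s i.-1 = (row s i).1 * (row s i).2.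
Proof. by move=> i_gt0; rewrite /mirror prednK. Qed.

(** Equal row products single out the quads labelled 1 to 8. *)
Lemma NN_balanced m X i : NN (2 * m)%N X -> (1 <= i <= m)%N ->
  balanced (row (seqC X) i) (row (seqD X) i).
Proof.
move=> nnX /andP[i_gt0 le_im].
have [_ _ sC sD] := NN_size nnX; have [_ _ bC bD] := NN_binary nnX.
have srC: sign_row (row (seqC X) i) by apply: row_sign; rewrite ?sC //; lia.
have srD: sign_row (row (seqD X) i) by apply: row_sign; rewrite ?sD //; lia.
split=> //.
have even2m: ~~ odd (2 * m) by rewrite oddM.
have := @NN_mirrorCD _ X i.-1 nnX even2m; rewrite !mirrorE // => mirCD.
have {mirCD} := mirCD ltac:(lia).
by case: srC srD => [[] -> [] ->] [[] -> [] ->].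
Qed.

Definition swap_row (r : int * int) := (r.2, r.1).

(** Entry k is the label of the quad labelled k after interchanging its rows; the
    next two tables are for the reversal of its upper and of its lower row. *)
Definition swap_label k := nth 0%N [:: 0; 1; 7; 3; 5; 4; 6; 2; 8]%N k.
Definition revC_label k := nth 0%N [:: 0; 1; 2; 4; 3; 6; 5; 7; 8]%N k.
Definition revD_label k := nth 0%N [:: 0; 1; 2; 5; 6; 3; 4; 7; 8]%N k.

Ltac by_quads :=
  let bal := fresh in
  move=> bal; case: bal => -[] /= [] -> [] -> [] /= [] -> [] -> => //.

Lemma label_swap r t : balanced r t -> label (t, r) = swap_label (label (r, t)).
Proof. by case: r t => [a a'] [b b']; by_quads. Qed.

Lemma label_revC r t :
  balanced r t -> label (swap_row r, t) = revC_label (label (r, t)).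
Proof. by case: r t => [a a'] [b b']; by_quads. Qed.

Lemma label_revD r t :
  balanced r t -> label (r, swap_row t) = revD_label (label (r, t)).
Proof. by case: r t => [a a'] [b b']; by_quads. Qed.

Lemma label_range r t : balanced r t -> label (r, t) \in iota 1 8.
Proof. by case: r t => [a a'] [b b']; by_quads. Qed.

(** The head of the list is the label that has to come first. *)
Definition skew_labels := [:: 6; 3; 4; 5]%N.

(** Outside the skew labels the rows are constant, so reversals do nothing. *)
Lemma label_sym r t :
  balanced r t -> label (r, t) \notin skew_labels -> swap_row r = r /\ swap_row t = t.
Proof. by case: r t => [a a'] [b b']; by_quads. Qed.

(** The labels left are 1, 8, 3 and 6. *)
Lemma label_eq_rows r t : balanced r t ->
  label (r, t) \notin [:: 7; 2]%N -> label (r, t) \notin [:: 5; 4]%N -> r = t.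
Proof. by case: r t => [a a'] [b b']; by_quads. Qed.

Lemma label_nth Q k : (k < 9)%N ->
  label Q = k <-> Q = nth ((0, 0), (0, 0)) quads k.
Proof.
move=> lt_k9; split=> [eqk | ->]; last exact: index_uniq.
by rewrite -eqk nth_index // -index_mem -/(label Q) eqk.
Qed.

(** The m quads cover all 2m positions. *)
Lemma eq_from_row m (s t : seq int) : size s = (2 * m)%N -> size t = (2 * m)%N ->
  (forall i, (1 <= i <= m)%N -> row s i = row t i) -> s = t.
Proof.
move=> ss st eqr; apply: eq_from_coef => [|i]; rewrite ss // => lt_i.
have [lt_im | le_mi] := ltnP i m; first by case: (eqr i.+1 lt_im).
have := congr1 snd (eqr (2 * m - i)%N ltac:(lia)).
by rewrite /= ss st subKn // ltnW.
Qed.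

Section LabelMoves.

Variables (m i : nat) (A B C D : seq int).
Hypotheses (nnX : NN (2 * m)%N (Quadruple A B C D)) (im : (1 <= i <= m)%N).
Let X := Quadruple A B C D.

Let i_size : (1 <= i <= 2 * m)%N.
Proof. by move: im; lia. Qed.

Lemma labelq_revC : labelq m (Quadruple A B (rev C) D) i = revC_label (labelq m X i).
Proof.
have [nnY _] := nn_revC nnX; have [/= _ _ sC _] := NN_size nnX.
rewrite !labelqE //= row_rev ?sC // label_revC //.
exact: (NN_balanced nnX im).
Qed.

Lemma labelq_revD : labelq m (Quadruple A B C (rev D)) i = revD_label (labelq m X i).
Proof.
have [nnY _] := nn_revD nnX; have [/= _ _ _ sD] := NN_size nnX.
rewrite !labelqE //= row_rev ?sD // label_revD //.
exact: (NN_balanced nnX im).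
Qed.

Lemma labelq_swap : labelq m (Quadruple A B D C) i = swap_label (labelq m X i).
Proof.
have [nnY _] := nn_swapCD nnX.
rewrite !labelqE //= label_swap //.
exact: (NN_balanced nnX im).
Qed.

End LabelMoves.

Lemma labelq_range m X i : NN (2 * m)%N X -> (1 <= i <= m)%N ->
  labelq m X i \in iota 1 8.
Proof. by move=> nnX im; rewrite labelqE // label_range //; exact: (NN_balanced nnX). Qed.

(** * First occurrences *)

Definition first_at (m : nat) (P : pred nat) (j : nat) : Prop :=
  [/\ (1 <= j <= m)%N, P j & forall i, (1 <= i < j)%N -> ~~ P i].

Lemma first_exists m (P : pred nat) :
  (exists j, first_at m P j) \/ (forall j, (1 <= j <= m)%N -> ~~ P j).
Proof.
have [ex | none] := boolP (has P (iota 1 m)); [left | right]; last first.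
  by move=> j jm; apply: (hasPn none); rewrite mem_iota add1n ltnS.
have exP: exists j, (1 <= j <= m)%N && P j.
  by case/hasP: ex => j; rewrite mem_iota add1n ltnS => jm Pj; exists j; rewrite jm.
case: (ex_minnP exP) => j /andP[jm Pj] minj; exists j; split=> // i im.
apply/negP=> Pi; have := minj i; rewrite Pi andbT.
by move: jm im => /andP[? ?] /andP[? ?] => /(_ ltac:(lia)); lia.
Qed.

Lemma first_at_inj m P j k : first_at m P j -> first_at m P k -> j = k.
Proof.
move=> [jm Pj minj] [km Pk mink].
have [lt_jk | lt_kj | //] := ltngtP j k.
  by have := mink j; rewrite Pj => /(_ ltac:(lia)).
by have := minj k; rewrite Pk => /(_ ltac:(lia)).
Qed.

(** Conditions (ii) to (iv) of the canonical form all have this shape, which is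
    easier to transport along relabellings than the existence of an earlier
    index. *)
Definition leads (m : nat) (q : nat -> nat) (S : seq nat) : Prop :=
  forall j, first_at m (fun i => q i \in S) j -> q j = head 0%N S.

(** As q 1 lies outside k :: S, a first occurrence is at an index larger than 1. *)
Lemma leadsP m q k S : q 1%N = 1%N -> 1%N \notin k :: S -> k \notin S ->
  leads m q (k :: S) <-> (forall j, (1 <= j <= m)%N -> q j \in S ->
     exists2 i, (1 < i < j)%N & q i = k).
Proof.
move=> q1 S1 Sk; split=> [ldS j jm qj | prec j [jm qj minj]].
  have [[i fst_i] | none] := first_exists m (fun i => q i \in k :: S); last first.
    by have := none j jm; rewrite inE qj orbT.
  have qi := ldS i fst_i; have [im _ mini] := fst_i; exists i => //.
  have i1: i != 1%N.
    by apply: contraNneq S1 => i1; rewrite -q1 -i1 qi mem_head.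
  have ij: i != j by apply: contraNneq Sk => ij; rewrite -[k]qi ij.
  have: ~~ (1 <= j < i)%N by apply/negP=> /mini; rewrite inE qj orbT.
  by move: im i1 ij jm; lia.
move: qj; rewrite inE => /orP[/eqP // | qj].
have [i ij qi] := prec j jm qj.
by have := minj i; rewrite qi mem_head => /(_ ltac:(lia)).
Qed.

Lemma canonicalP m X :
  canonical_form m X <->
  [/\ labelp m X 1 = 0%N, labelq m X 1 = 1%N,
      leads m (labelq m X) [:: 7; 2]%N, leads m (labelq m X) skew_labels
    & (forall k, (1 <= k <= m)%N -> labelq m X k <> 7%N) ->
      leads m (labelq m X) [:: 5; 4]%N].
Proof.
have mem1E (k l : nat) : k \in [:: l] <-> k = l.
  by rewrite inE; split=> [/eqP | ->].
split=> [[[p1 q1] c2 c3 c4] | [p1 q1 c2 c3 c4]]; split=> //.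
- by apply/leadsP=> // j jm /mem1E; apply: c2.
- by apply/leadsP.
- by move=> no7; apply/leadsP=> // j jm /mem1E; apply: c4.
- by move=> j jm /mem1E; apply/(leadsP m _ _ _).1.
- by apply/(leadsP m _ _ _).1.
- by move=> /c4 ld j jm /mem1E; apply/(leadsP m _ _ _).1: j jm.
Qed.

(** * Uniqueness *)

Lemma NN_row1B m X : (0 < m)%N -> NN (2 * m)%N X ->
  row (seqB X) 1 = ((row (seqA X) 1).1, - (row (seqA X) 1).2).
Proof.
move=> m_gt0 nnX; have [sA sB _ _] := NN_size nnX.
rewrite /row sA sB /= subn1 /= (NN_lastB nnX) (NN_nthB nnX) ?mul1r //.
by rewrite muln_gt0.
Qed.

(** For near-normal sequences the lower row of the first quad is determined by the
    upper one. *)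
Lemma labelp1P m X : (0 < m)%N -> NN (2 * m)%N X ->
  labelp m X 1 = 0%N <-> row (seqA X) 1 = (1, 1).
Proof.
move=> m_gt0 nnX; rewrite labelpE // label_nth // (NN_row1B m_gt0 nnX).
by case: (row _ 1) => a a' /=; split=> [[-> ->] | [-> ->]].
Qed.

Lemma labelq1P m X : NN (2 * m)%N X ->
  labelq m X 1 = 1%N <-> row (seqC X) 1 = (1, 1) /\ row (seqD X) 1 = (1, 1).
Proof.
move=> nnX; rewrite labelqE // label_nth //.
case: (row (seqC X) 1) (row (seqD X) 1) => [a a'] [b b'].
by split=> [[-> -> -> ->] | [[-> ->] [-> ->]]].
Qed.

Lemma NN_eqA_eqB n X Y : NN n X -> NN n Y -> seqA X = seqA Y -> seqB X = seqB Y.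
Proof.
move=> nnX nnY eqA; have [_ sBX _ _] := NN_size nnX; have [_ sBY _ _] := NN_size nnY.
apply: eq_from_coef => [|i]; rewrite sBX // ltnS leq_eqVlt => /orP[/eqP -> | lt_in].
  by rewrite (NN_lastB nnX) (NN_lastB nnY) eqA.
by rewrite (NN_nthB nnX) // (NN_nthB nnY) // eqA.
Qed.

(** The relation expressing B through A is invertible termwise. *)
Lemma NN_eqB_eqA n X Y : NN n X -> NN n Y -> seqB X = seqB Y -> seqA X = seqA Y.
Proof.
move=> nnX nnY eqB; have [sAX _ _ _] := NN_size nnX; have [sAY _ _ _] := NN_size nnY.
apply: eq_from_coef => [|i]; rewrite sAX // ltnS leq_eqVlt => /orP[/eqP -> | lt_in].
  by apply: oppr_inj; rewrite -(NN_lastB nnX) -(NN_lastB nnY) eqB.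
apply: (can_inj (mulKr (unitrX i (unitrN1 int)))).
by rewrite -(NN_nthB nnX) // -(NN_nthB nnY) // eqB.
Qed.

Lemma row_negate s i : row (negate s) i = (- (row s i).1, - (row s i).2).
Proof. by rewrite /row size_negate !nth_negate. Qed.

(** The end terms have product 1 in A and -1 in B, so A and B are not
    interchanged, and the signs of the end terms leave A or its reversal for the
    new A, and B or its negated reversal for the new B. Each of A, B determines
    the other, so a mixed choice forces equality as well. Both reversals at once
    contradict the alternation rule at the second term. *)
Lemma unique_AB m X Y : (0 < m)%N -> NN (2 * m)%N X -> NN (2 * m)%N Y ->
    row (seqA X) 1 = (1, 1) -> row (seqA Y) 1 = (1, 1) ->
    akin_pair (seqA X) (seqB X) (seqA Y) (seqB Y) ->
  seqA Y = seqA X /\ seqB Y = seqB X.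
Proof.
move=> m_gt0 nnX nnY rAX rAY.
have [sA sB _ _] := NN_size nnX; have [bA _ _ _] := NN_binary nnX.
have rBX := NN_row1B m_gt0 nnX; have rBY := NN_row1B m_gt0 nnY.
rewrite rAX /= in rBX; rewrite rAY /= in rBY.
case=> -[aA aB]; last first.
  have := akin_mirror (i := 0) _ aA; rewrite sB => /(_ isT).
  by rewrite !(mirrorE _ (ltn0Sn 0)) rAY rBX.
have caseA: seqA Y = seqA X \/ seqA Y = rev (seqA X).
  case: aA rAY => ->; [by left | | by right | ];
    by rewrite row_negate ?row_rev ?sA // rAX.
have caseB: seqB Y = seqB X \/ seqB Y = negate (rev (seqB X)).
  case: aB rBY => ->; [by left | | | by right];
    by rewrite ?row_negate ?row_rev ?sB // rBX.
case: caseA => [eqA | revA]; first by split=> //; exact: (NN_eqA_eqB nnY nnX eqA).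
case: caseB => [eqB | revB]; first by split=> //; exact: (NN_eqB_eqA nnY nnX eqB).
(* The term of index 1 is not the last one of B, because n >= 2. *)
have lt1 : (1 < 2 * m)%N by lia.
have ltn1: ((2 * m).-1 < 2 * m)%N by lia.
have := NN_nthB nnY lt1; rewrite revA revB nth_negate !nth_rev ?sA ?sB //; try lia.
have ->: ((2 * m).+1 - 2 = (2 * m).-1)%N by lia.
rewrite (NN_nthB nnX) // -signr_odd -subn1 oddB ?oddM //; last by lia.
have: (seqA X)`_((2 * m) - 1) = 1 \/ (seqA X)`_((2 * m) - 1) = -1.
  by apply: binary_nth; rewrite // sA; lia.
by case=> ->.
Qed.

Definition revert (r : bool) (s : seq int) := if r then rev s else s.

(** The end terms being all positive excludes negation. *)
Lemma akin_positive s t : (0 < size s)%N ->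
  row s 1 = (1, 1) -> row t 1 = (1, 1) -> akin s t -> exists r, t = revert r s.
Proof.
move=> s_gt0 rs rt [] eqt; move: rt; rewrite eqt.
- by exists false.
- by rewrite row_negate rs.
- by exists true.
- by rewrite row_negate row_rev // rs.
Qed.

Definition act_label (r1 r2 : bool) k :=
  let k1 := if r1 then revC_label k else k in if r2 then revD_label k1 else k1.

Lemma NN_revert m A B C D r1 r2 : NN (2 * m)%N (Quadruple A B C D) ->
  let Y := Quadruple A B (revert r1 C) (revert r2 D) in
  nn_equiv (2 * m)%N (Quadruple A B C D) Y /\
  forall i, (1 <= i <= m)%N ->
    labelq m Y i = act_label r1 r2 (labelq m (Quadruple A B C D) i).
Proof.
move=> nnX.
have {nnX} [eqv1 lab1]: nn_equiv (2 * m)%N (Quadruple A B C D)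
    (Quadruple A B (revert r1 C) D) /\ forall i, (1 <= i <= m)%N ->
    labelq m (Quadruple A B (revert r1 C) D) i
      = act_label r1 false (labelq m (Quadruple A B C D) i).
  case: r1; last by split=> //; apply: nn_equiv_refl.
  by split=> [|i im]; [apply: nn_revC | apply: labelq_revC].
have nn1 := eqv1.1.
case: r2 => /=; last by split.
split=> [|i im]; first by apply: nn_equiv_trans eqv1 (nn_revD nn1).
by rewrite labelq_revD // lab1.
Qed.

(** Without skew quads every row is constant, so C and D are palindromes. *)
Lemma symmetric_revert m X r1 r2 : NN (2 * m)%N X ->
    (forall i, (1 <= i <= m)%N -> labelq m X i \notin skew_labels) ->
  revert r1 (seqC X) = seqC X /\ revert r2 (seqD X) = seqD X.
Proof.
move=> nnX noskew; have [_ _ sC sD] := NN_size nnX.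
have sym i : (1 <= i <= m)%N ->
    swap_row (row (seqC X) i) = row (seqC X) i
    /\ swap_row (row (seqD X) i) = row (seqD X) i.
  move=> im; apply: label_sym; first exact: (NN_balanced nnX im).
  by rewrite -(labelqE i nnX); apply: noskew.
split; [case: r1 | case: r2] => //=;
  apply: (@eq_from_row m); rewrite ?size_rev // => i im;
  by rewrite row_rev ?sC ?sD; [case: (sym i im) | move: im; lia].
Qed.

(** A relabelling f that preserves membership in S does not move the first
    occurrence of S; it only changes the label found there. *)
Section Relabelling.

Variables (m : nat) (f : nat -> nat) (q q' : nat -> nat) (S : seq nat).
Hypothesis q_range : forall i, (1 <= i <= m)%N -> q i \in iota 1 8.
Hypothesis q'E : forall i, (1 <= i <= m)%N -> q' i = f (q i).
Hypothesis fS : all (fun k => (f k \in S) == (k \in S)) (iota 1 8).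

Lemma relabel_mem i : (1 <= i <= m)%N -> (q' i \in S) = (q i \in S).
Proof. by move=> im; rewrite q'E //; apply/eqP/(allP fS)/q_range. Qed.

Lemma first_at_relabel j :
  first_at m (fun i => q' i \in S) j <-> first_at m (fun i => q i \in S) j.
Proof.
split=> -[jm qj minj]; split=> //; rewrite ?relabel_mem // -?relabel_mem // => i ij.
  by rewrite -relabel_mem; [apply: minj | lia].
by rewrite relabel_mem; [apply: minj | lia].
Qed.

Lemma leads_relabel_fixed :
  f (head 0%N S) = head 0%N S -> leads m q S -> leads m q' S.
Proof.
move=> fix_hd ld j /first_at_relabel fst_j.
by rewrite q'E ?(ld j fst_j) //; case: fst_j.
Qed.

Lemma leads_relabel_moved : f (head 0%N S) != head 0%N S ->
  leads m q S -> leads m q' S -> forall i, (1 <= i <= m)%N -> q i \notin S.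
Proof.
move=> /eqP move_hd ld ld'.
have [[j fst_j] | //] := first_exists m (fun i => q i \in S).
case: move_hd; rewrite -{1}(ld j fst_j) -q'E; last by case: fst_j.
exact/ld'/first_at_relabel.
Qed.

Lemma leads_relabel_to j : first_at m (fun i => q i \in S) j ->
  f (q j) = head 0%N S -> leads m q' S.
Proof.
move=> fst_j fqj k /first_at_relabel fst_k.
by rewrite (first_at_inj fst_k fst_j) q'E //; case: fst_j.
Qed.

End Relabelling.

Lemma leads_none m q S : (forall i, (1 <= i <= m)%N -> q i \notin S) -> leads m q S.
Proof. by move=> none j [jm qj _]; rewrite (negbTE (none j jm)) in qj. Qed.

(** Only the trivial reversal fixes the label 6, which both quadruples have at
    their common first skew quad. *)
Lemma unique_revert m A B C D r1 r2 : NN (2 * m)%N (Quadruple A B C D) ->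
  let X := Quadruple A B C D in
  let Y := Quadruple A B (revert r1 C) (revert r2 D) in
  leads m (labelq m X) skew_labels -> leads m (labelq m Y) skew_labels -> Y = X.
Proof.
move=> nnX X Y ldX ldY.
have [_ labY] := NN_revert r1 r2 nnX.
have [r_eq | r_act] := boolP (act_label r1 r2 6 == 6%N).
  by rewrite /Y; case: r1 r2 r_eq {Y ldY labY} => [] [].
have fS: all (fun k => (act_label r1 r2 k \in skew_labels) == (k \in skew_labels))
    (iota 1 8) by case: (r1) (r2) => [] [].
have noskew := leads_relabel_moved (S := skew_labels)
  (fun i => labelq_range nnX) labY fS r_act ldX ldY.
have [] := symmetric_revert r1 r2 nnX noskew.
by rewrite /Y /= => -> ->.
Qed.

(** The interchange preserves the condition on the skew labels, so it suffices to
    compare after it, where no reversal is left. It moves the heads 7 and 5 of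
    the two other conditions, hence none of 7, 2, 5, 4 occurs and C = D. *)
Lemma unique_CD m A B C D C' D' :
    NN (2 * m)%N (Quadruple A B C D) -> NN (2 * m)%N (Quadruple A B C' D') ->
    canonical_form m (Quadruple A B C D) -> canonical_form m (Quadruple A B C' D') ->
    (exists r1 r2, C' = revert r1 C /\ D' = revert r2 D) \/
    (exists r1 r2, C' = revert r1 D /\ D' = revert r2 C) ->
  Quadruple A B C' D' = Quadruple A B C D.
Proof.
move=> nnX nnY /canonicalP[_ q1X ld7X ld6X ld5X] /canonicalP[_ q1Y ld7Y ld6Y ld5Y].
case=> -[r1 [r2 [eqC eqD]]].
  by subst C' D'; apply: (@unique_revert m) ld6X ld6Y.
have [nnZ _] := nn_swapCD nnX.
have labZ i (im : (1 <= i <= m)%N) := labelq_swap nnX im.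
have rangeX i := @labelq_range m _ i nnX.
have ld6Z := leads_relabel_fixed (S := skew_labels) rangeX labZ isT erefl ld6X.
have eqYZ: Quadruple A B C' D' = Quadruple A B D C.
  by move: ld6Y; rewrite eqC eqD; apply: (@unique_revert m) ld6Z.
rewrite eqYZ in ld7Y ld5Y *.
have no72 := leads_relabel_moved (S := [:: 7; 2]%N) rangeX labZ isT isT ld7X ld7Y.
have no54 : forall i, (1 <= i <= m)%N -> labelq m (Quadruple A B C D) i \notin [:: 5; 4]%N.
  apply: (leads_relabel_moved (S := [:: 5; 4]%N) rangeX labZ) => //.
    by apply: ld5X => k km qk; have := no72 k km; rewrite qk.
  by apply: ld5Y => k km qk; have := no72 k km;
     rewrite -(relabel_mem (S := [:: 7; 2]%N) rangeX labZ) ?qk.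
have [/= _ _ sC sD] := NN_size nnX.
suff ->: C = D by [].
apply: (eq_from_row sC sD) => i im.
by apply: (label_eq_rows (NN_balanced nnX im)); rewrite -(labelqE i nnX);
  [apply: no72 | apply: no54].
Qed.

Lemma canonical_unique m X Y : (0 < m)%N ->
    NN (2 * m)%N X -> NN (2 * m)%N Y -> BS_equiv X Y ->
    canonical_form m X -> canonical_form m Y -> Y = X.
Proof.
move=> m_gt0 nnX nnY /BS_equiv_akin[e [pAB pCD]] cfX cfY.
have [[p1X q1X] _ _ _] := cfX; have [[p1Y q1Y] _ _ _] := cfY.
have rAX := (labelp1P m_gt0 nnX).1 p1X; have rAY := (labelp1P m_gt0 nnY).1 p1Y.
have [rCX rDX] := (labelq1P nnX).1 q1X; have [rCY rDY] := (labelq1P nnY).1 q1Y.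
have [_ _ sC sD] := NN_size nnX.
have n_gt0 : (0 < 2 * m)%N by rewrite muln_gt0.
have odd_n1 : (-1) ^+ (2 * m).-1 = -1 :> int.
  by rewrite -signr_odd -subn1 oddB // oddM.
have no_alt s t : size s = (2 * m)%N -> row s 1 = (1, 1) -> row t 1 = (1, 1) ->
    akin (alternate s) t -> False.
  move=> ss rs rt /(akin_mirror (i := 0)); rewrite size_alternate ss => /(_ n_gt0).
  by rewrite mirror_alternate ss // odd_n1 !(mirrorE _ (ltn0Sn 0)) rs rt.
case: e pAB pCD => [_ | /= pAB pCD].
  by rewrite /= => -[] [/no_alt aC _]; case: aC; rewrite ?sC ?sD.
have [eqA eqB] := unique_AB m_gt0 nnX nnY rAX rAY pAB.
clear pAB rAX rAY p1X p1Y q1X q1Y.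
case: X Y => A B C D [A' B' C' D'] /= in nnX nnY cfX cfY rCX rDX rCY rDY sC sD pCD eqA eqB *.
subst A' B'.
apply: (@unique_CD m) => //.
case: pCD => -[aC aD]; [left | right].
  have [|r1 ->] := akin_positive _ rCX rCY aC; first by rewrite sC.
  have [|r2 ->] := akin_positive _ rDX rDY aD; first by rewrite sD.
  by exists r1, r2.
have [|r1 ->] := akin_positive _ rDX rCY aC; first by rewrite sD.
have [|r2 ->] := akin_positive _ rCX rDY aD; first by rewrite sC.
by exists r1, r2.
Qed.

(** * Existence *)

(** Exactly one of A and B has equal end terms. *)
Lemma exists_normal_AB m X : (0 < m)%N -> NN (2 * m)%N X ->
  exists2 Y, nn_equiv (2 * m)%N X Y & row (seqA Y) 1 = (1, 1).
Proof.
case: X => A B C D m_gt0 nnX.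
have rB : row B 1 = ((row A 1).1, - (row A 1).2) := NN_row1B m_gt0 nnX.
have [/= sA _ _ _] := NN_size nnX; have [/= bA _ _ _] := NN_binary nnX.
have [sgn_a sgn_a'] : sign_row (row A 1) by apply: row_sign; rewrite ?sA.
have := surjective_pairing (row A 1).
case: sgn_a' rB => ->; case: sgn_a => ->; rewrite ?opprK => rB rA.
- by exists (Quadruple A B C D) => //; apply: nn_equiv_refl.
- have eqv := nn_swapAB nnX; have nnY := eqv.1.
  exists (Quadruple (negate B) (negate A) C D).
    exact: nn_equiv_trans eqv (nn_negAB nnY).
  by rewrite /= row_negate rB opprK.
- by exists (Quadruple B A C D) => //; apply: nn_swapAB.
exists (Quadruple (negate A) (negate B) C D); first exact: nn_negAB.
by rewrite /= row_negate rA opprK.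
Qed.

Lemma row1_alternate s : row (alternate s) 1
  = ((row s 1).1, (-1) ^+ (size s).-1 * (row s 1).2).
Proof. by rewrite /row size_alternate !nth_alternate mul1r subn1. Qed.

(** Alternation changes the sign of the last term of C and D, whose length is
    even, and keeps the first terms and the last term of A. *)
Lemma exists_normal_CD m X : (0 < m)%N -> NN (2 * m)%N X ->
    row (seqA X) 1 = (1, 1) ->
  exists2 Y, nn_equiv (2 * m)%N X Y &
    [/\ row (seqA Y) 1 = (1, 1), row (seqC Y) 1 = (1, 1) & row (seqD Y) 1 = (1, 1)].
Proof.
move=> m_gt0 nnX rA.
have even2m : ~~ odd (2 * m) by rewrite oddM.
have [Y [nnY eqXY] [rAY symC]] : exists2 Y, nn_equiv (2 * m)%N X Y &
    row (seqA Y) 1 = (1, 1) /\ (row (seqC Y) 1).1 = (row (seqC Y) 1).2.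
  have [[c_sgn c'_sgn] _ _] := NN_balanced (i := 1%N) nnX m_gt0.
  have [eq_c | neq_c] := eqVneq (row (seqC X) 1).1 (row (seqC X) 1).2.
    by exists X => //; apply: nn_equiv_refl.
  have [sA _ sC _] := NN_size nnX.
  case: X => A B C D /= in nnX rA c_sgn c'_sgn neq_c sA sC *.
  exists (Quadruple (alternate A) (alternate B) (alternate C) (alternate D)).
    exact: nn_alternate.
  rewrite /= row1_alternate rA sA /= -signr_odd (negbTE even2m) mulr1; split=> //.
  rewrite !nth_alternate size_alternate mul1r sC in c'_sgn neq_c *.
  rewrite -signr_odd oddB ?muln_gt0 // oddM /=.
  by case: c_sgn c'_sgn neq_c => -> [] ->.
have [_ [d_sgn d'_sgn] eq_cd] := NN_balanced (i := 1%N) nnY m_gt0.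
have [[c_sgn _] _ _] := NN_balanced (i := 1%N) nnY m_gt0.
have symD : (row (seqD Y) 1).1 = (row (seqD Y) 1).2.
  move: eq_cd; rewrite -symC.
  by case: c_sgn => ->; case: d_sgn => ->; case: d'_sgn => ->.
have [Z [nnZ eqYZ] [rAZ rCZ symDZ d_sgnZ]] : exists2 Z, nn_equiv (2 * m)%N Y Z &
    [/\ row (seqA Z) 1 = (1, 1), row (seqC Z) 1 = (1, 1),
        (row (seqD Z) 1).1 = (row (seqD Z) 1).2 & is_sign (row (seqD Z) 1).1].
  case: c_sgn => eq_c.
    exists Y; first exact: nn_equiv_refl.
    by split=> //; rewrite [LHS]surjective_pairing -symC eq_c.
  case: Y => A B C D /= in nnY eqXY rAY symC symD d_sgn eq_c d'_sgn eq_cd *.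
  exists (Quadruple A B (negate C) D); first exact: nn_negC.
  by split=> //=; rewrite row_negate /= -symC eq_c opprK.
case: d_sgnZ => eq_d.
  exists Z; first by split=> //; apply: rt_trans eqXY eqYZ.
  by split=> //; rewrite [LHS]surjective_pairing -symDZ eq_d.
case: Z => A B C D /= in nnZ eqYZ rAZ rCZ symDZ eq_d *.
exists (Quadruple A B C (negate D)).
  have [nnT eqZT] := nn_negD nnZ; split=> //.
  by apply: rt_trans (rt_trans _ _ _ _ _ eqXY eqYZ) eqZT.
by split=> //=; rewrite row_negate /= -symDZ eq_d opprK.
Qed.

(** The four combinations of reversals carry the four skew labels to 6. *)
Lemma exists_leads_skew m X : NN (2 * m)%N X ->
  exists2 Y, nn_equiv (2 * m)%N X Y &
    [/\ seqA Y = seqA X, labelq m X 1 = 1%N -> labelq m Y 1 = 1%N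
      & leads m (labelq m Y) skew_labels].
Proof.
move=> nnX; have rangeX i := @labelq_range m _ i nnX.
have [[j fst_j] | none] := first_exists m (fun i => labelq m X i \in skew_labels);
  last first.
  by exists X; [exact: nn_equiv_refl | split=> //; apply: leads_none].
have [jm qj _] := fst_j.
have [r1 [r2 act_j]] : exists r1 r2, act_label r1 r2 (labelq m X j) = 6%N.
  move: qj; rewrite !inE => /or4P[] /eqP ->.
  - by exists false, false.
  - by exists true, true.
  - by exists false, true.
  by exists true, false.
case: X => A B C D in nnX rangeX fst_j qj act_j *.
have [eqvXY labY] := NN_revert r1 r2 nnX.
exists (Quadruple A B (revert r1 C) (revert r2 D)) => //; split=> // [q1|].
  have m_gt0: (0 < m)%N by move: jm; lia.
  by rewrite labY ?q1 //; case: (r1) (r2) => [] [].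
apply: (leads_relabel_to (S := skew_labels) rangeX labY _ fst_j act_j).
by case: (r1) (r2) => [] [].
Qed.

(** The interchange is used if the first label among 7, 2 is 2 or, when there is no
    such label, if the first one among 5, 4 is 4. *)
Lemma exists_leads_swap m X : (0 < m)%N -> NN (2 * m)%N X ->
    labelq m X 1 = 1%N -> leads m (labelq m X) skew_labels ->
  exists2 Y, nn_equiv (2 * m)%N X Y &
    [/\ seqA Y = seqA X, labelq m Y 1 = 1%N, leads m (labelq m Y) skew_labels,
        leads m (labelq m Y) [:: 7; 2]%N &
        (forall k, (1 <= k <= m)%N -> labelq m Y k <> 7%N) ->
          leads m (labelq m Y) [:: 5; 4]%N].
Proof.
move=> m_gt0 nnX q1 ld6; have rangeX i := @labelq_range m _ i nnX.
case: X => A B C D in nnX q1 ld6 rangeX *.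
set X := Quadruple A B C D in nnX q1 ld6 rangeX *.
have labZ i (im : (1 <= i <= m)%N) := labelq_swap nnX im.
have ld6Z := leads_relabel_fixed (S := skew_labels) rangeX labZ isT erefl ld6.
have q1Z : labelq m (Quadruple A B D C) 1 = 1%N by rewrite labZ ?q1.
have reflX := nn_equiv_refl nnX; have swapX := nn_swapCD nnX.
have [[j fst_j] | none72] := first_exists m (fun i => labelq m X i \in [:: 7; 2]%N).
  have [jm qj _] := fst_j; move: qj; rewrite !inE => /orP[] /eqP qj.
    exists X => //; split=> // [k fst_k | no7]; last by case: (no7 j jm).
    by rewrite (first_at_inj fst_k fst_j).
  exists (Quadruple A B D C) => //; split=> // [|no7].
    by apply: (leads_relabel_to (S := [:: 7; 2]%N) rangeX labZ isT fst_j); rewrite qj.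
  by case: (no7 j jm); rewrite labZ // qj.
have ld7 := leads_none none72.
have [[j fst_j] | none54] := first_exists m (fun i => labelq m X i \in [:: 5; 4]%N).
  have [jm qj _] := fst_j; move: qj; rewrite !inE => /orP[] /eqP qj.
    by exists X => //; split=> // _ k fst_k; rewrite (first_at_inj fst_k fst_j).
  exists (Quadruple A B D C) => //; split=> // [|_].
    apply: leads_none => i im.
    by rewrite (relabel_mem (S := [:: 7; 2]%N) rangeX labZ) //; apply: none72.
  by apply: (leads_relabel_to (S := [:: 5; 4]%N) rangeX labZ isT fst_j); rewrite qj.
by exists X => //; split=> // _; apply: leads_none.
Qed.

Lemma canonical_exists m X : (0 < m)%N -> NN (2 * m)%N X ->
  exists2 Y, nn_equiv (2 * m)%N X Y & canonical_form m Y.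
Proof.
move=> m_gt0 nnX.
have [X1 eqv1 rA1] := exists_normal_AB m_gt0 nnX; have nn1 := eqv1.1.
have [X2 eqv2 [rA2 rC2 rD2]] := exists_normal_CD m_gt0 nn1 rA1; have nn2 := eqv2.1.
have q1 : labelq m X2 1 = 1%N by apply/(labelq1P nn2).
have [X3 eqv3 [eqA3 /(_ q1) q13 ld6]] := exists_leads_skew nn2; have nn3 := eqv3.1.
have [X4 eqv4 [eqA4 q14 ld64 ld74 ld54]] := exists_leads_swap m_gt0 nn3 q13 ld6.
exists X4.
  exact: nn_equiv_trans (nn_equiv_trans eqv1 eqv2) (nn_equiv_trans eqv3 eqv4).
apply/canonicalP; split=> //.
by apply/(labelp1P m_gt0 eqv4.1); rewrite eqA4 eqA3.
Qed.

Lemma BS_equiv_sym X Y : BS_equiv X Y -> BS_equiv Y X.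
Proof.
elim=> [{}X {}Y stepXY | Z | {}X Z {}Y _ eZX _ eYZ].
- apply: rt_step; case: stepXY => A B C D.
  + by rewrite -{2}[A]negateK; apply: NegA.
  + by rewrite -{2}[B]negateK; apply: NegB.
  + by rewrite -{2}[C]negateK; apply: NegC.
  + by rewrite -{2}[D]negateK; apply: NegD.
  + by rewrite -{2}[A]revK; apply: RevA.
  + by rewrite -{2}[B]revK; apply: RevB.
  + by rewrite -{2}[C]revK; apply: RevC.
  + by rewrite -{2}[D]revK; apply: RevD.
  + exact: SwapAB.
  + exact: SwapCD.
  rewrite -{2}[A]alternateK -{2}[B]alternateK -{2}[C]alternateK -{2}[D]alternateK.
  exact: AltAll.
- exact: rt_refl.
exact: rt_trans eYZ eZX.
Qed.

Theorem proposition3p2 (m : nat) (m_gt0 : (0 < m)%N)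
    (E : quadruple -> Prop) (classE : BS_class (2 * m)%N E) :
  exists! X : quadruple, E X /\ canonical_form m X.
Proof.
case: classE => X nnX defE.
have [Y eqvXY cfY] := canonical_exists m_gt0 nnX.
exists Y; split=> [|Z [/defE[nnZ eqvXZ] cfZ]]; first by split; first exact/defE.
have eqvZY := rt_trans _ _ _ _ _ (BS_equiv_sym eqvXZ) eqvXY.2.
exact: (canonical_unique m_gt0 nnZ eqvXY.1 eqvZY cfZ cfY).
Qed.
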